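(* Let $(\mathcal N,\mathcal O,\mathfrak l)$ be a plabic network with orientation $\mathcal O$ and gauge ray direction $\mathfrak l$. The edge vectors $E_e$ on $(\mathcal N,\mathcal O,\mathfrak l)$ satisfy the following linear equations at each internal vertex (where $E_m$ denotes the vector of the edge $e_m$ and $w_m$ its weight): (1) at each bivalent vertex with incoming edge $e$ and outgoing edge $f$: $E_e=(-1)^{\mathrm{int}(e)+\mathrm{wind}(e,f)}w_eE_f$; (2) at each trivalent black vertex with incoming edges $e_2,e_3$ and outgoing edge $e_1$: $E_2=(-1)^{\mathrm{int}(e_2)+\mathrm{wind}(e_2,e_1)}w_2E_1$ and $E_3=(-1)^{\mathrm{int}(e_3)+\mathrm{wind}(e_3,e_1)}w_3E_1$; (3) at each trivalent white vertex with incoming edge $e_3$ and outgoing edges $e_1,e_2$: $E_3=(-1)^{\mathrm{int}(e_3)+\mathrm{wind}(e_3,e_1)}w_3E_1+(-1)^{\mathrm{int}(e_3)+\mathrm{wind}(e_3,e_2)}w_3E_2$.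
   Context: Fix positive integers $k<n$. A plabic graph of type $(k,n)$ is a finite directed graph drawn planarly in a disk, with no component isolated from the boundary, such that: it has $n$ boundary vertices $b_1,\dots,b_n$ labelled clockwise, all on a common straight interval of the boundary of the disk, each of degree 1 (a boundary source if its edge is outgoing, a boundary sink if incoming; exactly $k$ are sources, indexed by $I=\{i_1<\dots<i_k\}$); all other (internal) vertices are strictly inside the disk and are bivalent or trivalent; each internal vertex either has exactly one incoming edge (white) or exactly one outgoing edge (black), bivalent vertices being assigned either colour. Edges are straight segments, regarded as vectors directed by the orientation $\mathcal O$. A plabic network $\mathcal N$ is a plabic graph with a positive weight $w_e$ on each edge. A gauge ray direction $\mathfrak l$ is an oriented direction such that the ray in direction $\mathfrak l$ from any boundary vertex points inside the disk, no internal edge is parallel to $\mathfrak l$, and the rays starting at boundary vertices contain no internal vertices. $\mathfrak l_i$ is the ray starting at $b_i$. For plane vectors $s(u,v)=+1,0,-1$ if $(u,v)$ is positively (counterclockwise) oriented, parallel, negatively oriented. For consecutive edges, $\mathrm{wind}(e,f)=\pm1$ if $s(e,f)=s(e,\mathfrak l)=s(\mathfrak l,f)=\pm1$, and $0$ otherwise. $\mathrm{int}(e)$ is the number of intersections of $e$ with the rays $\mathfrak l_{i_r}$, $r\in[k]$ (the common starting point of $\mathfrak l_{i_r}$ and the edge at $b_{i_r}$ is not counted). For a directed path $\mathcal P=(e_1,\dots,e_m)$ (edges may repeat): $w(\mathcal P)=\prod w_{e_l}$ with multiplicity, $\mathrm{wind}(\mathcal P)=\sum_{l=1}^{m-1}\mathrm{wind}(e_l,e_{l+1})$,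 $\mathrm{int}(\mathcal P)=\sum_{l=1}^m\mathrm{int}(e_l)$. The edge vector $E_e$ has components $(E_e)_j=\sum_{\mathcal P:e\to b_j}(-1)^{\mathrm{wind}(\mathcal P)+\mathrm{int}(\mathcal P)}w(\mathcal P)$, $j\in[n]$, the sum over all directed paths with first edge $e$ ending at the boundary vertex $b_j$ (zero if there is none); the sum is a formal power series in the weights, convergent for sufficiently small weights. *)

(* Defs.v *)
From HB Require Import structures.
From mathcomp Require Import all_boot all_order all_algebra.
From mathcomp Require Import all_classical all_reals all_analysis.
Set Implicit Arguments.
Unset Strict Implicit.
Unset Printing Implicit Defensive.
Import Order.TTheory GRing.Theory Num.Theory.
Import numFieldNormedType.Exports.
Local Open Scope classical_set_scope.
Local Open Scope ring_scope.

Section Plane.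
Variable R : realType.
Implicit Types p q u v l : R * R.

Definition unit_disk : set (R * R) := [set p | p.1 ^+ 2 + p.2 ^+ 2 <= 1].

(* A continuous injection on a compact set is a homeomorphism onto its image. *)
Definition closed_disk (D : set (R * R)) : Prop :=
  exists f : R * R -> R * R,
    [/\ {within unit_disk, continuous f},
        {in unit_disk &, injective f} & f @` unit_disk = D].

Definition translate p u (t : R) : R * R := (p.1 + t * u.1, p.2 + t * u.2).

Definition seg p q : set (R * R) :=
  [set translate p (q - p) t | t in [set t : R | 0 <= t <= 1]].

Definition ray p l : set (R * R) :=
  [set translate p l t | t in [set t : R | 0 <= t]].

Definition points_inside (D : set (R * R)) p u : Prop :=
  \forall t \near 0^'+, interior D (translate p u t).

Definition right_normal u : R * R := (u.2, - u.1).

(* +1, 0, -1 according to the orientation of the pair (u, v). *)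
Definition s_orient u v : int := sgz (u.1 * v.2 - u.2 * v.1).

Definition wind_vec l u v : int :=
  if (s_orient u v == s_orient u l) && (s_orient u l == s_orient l v)
  then s_orient u v else 0.

End Plane.

Record plabic_graph (R : realType) (k n : nat) := PlabicGraph {
  vertex : finType;
  edge : finType;
  src : edge -> vertex;
  tgt : edge -> vertex;
  bnd : 'I_n -> vertex;
  white : pred vertex;

  internal (v : vertex) : bool := v \notin codom bnd;
  indeg (v : vertex) : nat := #|[pred e | tgt e == v]|;
  outdeg (v : vertex) : nat := #|[pred e | src e == v]|;
  degree (v : vertex) : nat := (indeg v + outdeg v)%N;
  adjacent : rel vertex := fun v v' =>
    [exists e, ((src e == v) && (tgt e == v')) ||
               ((src e == v') && (tgt e == v))];

  bnd_inj : injective bnd;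
  bnd_degree : forall i, degree (bnd i) = 1%N;
  num_sources : #|[pred i | outdeg (bnd i) == 1%N]| = k;
  internal_degree : forall v, internal v -> degree v = 2%N \/ degree v = 3%N;
  white_indeg : forall v, internal v -> white v -> indeg v = 1%N;
  black_outdeg : forall v, internal v -> ~~ white v -> outdeg v = 1%N;
  no_isolated_component : forall v, exists i, connect adjacent v (bnd i);

  disk : set (R * R);
  pos : vertex -> R * R;
  disk_is_disk : closed_disk disk;
  pos_inj : injective pos;
  internal_inside : forall v, internal v -> interior disk (pos v);
  edge_nondegenerate : forall e, src e != tgt e;
  edge_in_disk : forall e, seg (pos (src e)) (pos (tgt e)) `<=` disk;
  (* distinct edges meet only at common end vertices *)
  planar : forall (e f : edge) p, e != f ->
    seg (pos (src e)) (pos (tgt e)) p -> seg (pos (src f)) (pos (tgt f)) p ->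
    exists v, [/\ p = pos v, v \in [:: src e; tgt e] & v \in [:: src f; tgt f]];

  interval_start : R * R;
  interval_dir : R * R;
  bnd_coord : 'I_n -> R;
  interval_dir_neq0 : interval_dir != 0;
  interval_boundary : forall t, 0 <= t <= 1 ->
    (disk `\` interior disk) (translate interval_start interval_dir t);
  (* The interval is directed clockwise along the boundary: the disk lies to
     its right. *)
  interval_clockwise : forall t, 0 < t < 1 ->
    points_inside disk (translate interval_start interval_dir t)
      (right_normal interval_dir);
  bnd_coord01 : forall i, 0 <= bnd_coord i <= 1;
  pos_bnd : forall i,
    pos (bnd i) = translate interval_start interval_dir (bnd_coord i);
  (* Clockwise labelling is cyclic: it need not start at the first boundary
     vertex of the interval. *)
  bnd_cyclic : forall i j l : 'I_n, (i < j < l)%N ->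
    [\/ bnd_coord i < bnd_coord j < bnd_coord l,
        bnd_coord j < bnd_coord l < bnd_coord i
      | bnd_coord l < bnd_coord i < bnd_coord j]
}.

Arguments src {R k n} _ _.
Arguments tgt {R k n} _ _.
Arguments bnd {R k n} _ _.
Arguments pos {R k n} _ _.
Arguments white {R k n} _ _.
Arguments internal {R k n} _ _.
Arguments degree {R k n} _ _.
Arguments outdeg {R k n} _ _.

Section EdgeVectors.
Variables (R : realType) (k n : nat) (G : plabic_graph R k n).
Implicit Types (l : R * R) (e f : edge G) (P : seq (edge G)) (w : edge G -> R).

Definition edge_seg e : set (R * R) := seg (pos G (src G e)) (pos G (tgt G e)).

Definition edge_vec e : R * R := pos G (tgt G e) - pos G (src G e).

Definition is_source (i : 'I_n) : bool := outdeg G (bnd G i) == 1%N.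

Definition internal_edge e : bool :=
  internal G (src G e) && internal G (tgt G e).

Record gauge_direction l : Prop := GaugeDirection {
  gauge_neq0 : l != 0;
  gauge_inside : forall i, points_inside (disk G) (pos G (bnd G i)) l;
  gauge_not_parallel : forall e, internal_edge e ->
    s_orient (edge_vec e) l != 0;
  gauge_avoids : forall i v, internal G v ->
    ~ ray (pos G (bnd G i)) l (pos G v)
}.

Definition wind l e f : int := wind_vec l (edge_vec e) (edge_vec f).

(* No edge is parallel to a gauge direction, so each ray meets an edge in at
   most one point and counting rays counts intersections.  By planarity b_i
   lies on no edge but its own, so excluding the point b_i removes exactly the
   common starting point of the ray and the edge at b_i. *)
Definition int_edge l e : nat :=
  #|[pred i | is_source i &&
      `[< exists p, [/\ edge_seg e p, ray (pos G (bnd G i)) l p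
                      & p <> pos G (bnd G i)] >]]|.

(* P is a directed path with first edge e ending at b_j *)
Definition path_to e (j : 'I_n) P : bool :=
  if P is e' :: P' then
    [&& e' == e, path (fun x y => tgt G x == src G y) e' P'
      & tgt G (last e' P') == bnd G j]
  else false.

Definition path_wind l P : int :=
  \sum_(q <- zip P (behead P)) wind l q.1 q.2.

Definition path_int l P : nat := \sum_(e <- P) int_edge l e.

Definition path_sign l P : R := (-1) ^ (path_wind l P + (path_int l P)%:Z).

Definition path_weight w P : R := \prod_(e <- P) w e.

(* Formal power series in the weights, with values in R^n (equivalently,
   n-tuples of power series); a monomial is its family of exponents. *)
Definition monomial := {ffun edge G -> nat}.
Definition vec_series := monomial -> 'rV[R]_n.

Definition mdegree (m : monomial) : nat := \sum_e m e.

(* A path whose weight is the monomial m has length mdegree m, so only finitely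
   many paths contribute to a given coefficient. *)
Definition edge_series l e : vec_series := fun m =>
  \row_j \sum_(P : (mdegree m).-tuple (edge G) |
                 path_to e j P && [forall x, count_mem x P == m x])
           path_sign l P.

(* multiplication by the indeterminate w_e *)
Definition mul_weight e (F : vec_series) : vec_series := fun m =>
  if m e is 0 then 0 else F [ffun x => (m x - (x == e))%N].

(* The value of the series for actual weights, paths being grouped by length *)
Definition edge_vector l w e : 'rV[R]_n :=
  \row_j limn (series (fun d : nat =>
    \sum_(P : d.-tuple (edge G) | path_to e j P)
      path_sign l P * path_weight w P)).

(* Absolute convergence, for positive weights, of all the sums over paths *)
Definition paths_converge w : Prop := forall e (j : 'I_n),
  cvgn (series (fun d : nat =>
    \sum_(P : d.-tuple (edge G) | path_to e j P) path_weight w P)).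

Lemma small_weights_converge : exists2 eps : R, 0 < eps &
  forall w, (forall e, 0 < w e < eps) -> paths_converge w.
Proof.
pose c : R := (#|edge G|.+1)%:R; have c0 : 0 < c by rewrite ltr0n.
exists (2 * c)^-1; first by rewrite invr_gt0 mulr_gt0.
move=> w hw e j; apply: (@series_le_cvg R _ (geometric 1 (2^-1))).
- by move=> d; apply: sumr_ge0 => P _; apply: prodr_ge0 => x _;
    case/andP: (hw x) => /ltW.
- by move=> d; rewrite /= mul1r exprn_ge0 // invr_ge0.
- move=> d /=; rewrite mul1r.
  apply: (@le_trans _ _ (\sum_(P : d.-tuple (edge G)) (2 * c)^-1 ^+ d)).
    rewrite big_mkcond; apply: ler_sum => P _.
    have le0 : 0 <= (2 * c)^-1 ^+ d by rewrite exprn_ge0 // invr_ge0 mulr_ge0 // ltW.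
    case: ifP => // _.
    rewrite /path_weight -[in leRHS](size_tuple P).
    elim: (tval P) => [|x s IHs]; first by rewrite big_nil.
    rewrite big_cons exprS; have /andP[/ltW w0 /ltW wle] := hw x.
    by apply: ler_pM => //; apply: prodr_ge0 => y _; case/andP: (hw y) => /ltW.
  rewrite sumr_const card_tuple -[leLHS]mulr_natr natrX -exprMn.
  apply: lerXn2r; rewrite ?nnegrE ?invr_ge0 ?mulr_ge0 ?invr_ge0 ?ler0n //.
    by rewrite mulr_ge0 // ltW.
  by rewrite invfM -mulrA ler_piMr ?invr_ge0 // mulrC ler_pdivrMr // mul1r ler_nat.
- by apply: is_cvg_geometric_series; rewrite ger0_norm ?invr_ge0 // invf_lt1 // ltr1n.
Qed.

End EdgeVectors.

(* Main.v *)
(* Peeling the first edge off a path issuing from [e] gives a path issuing from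
   one of the edges that leave the target of [e]; as that vertex is internal, no
   path stops there. *)
Require Import Defs.
From HB Require Import structures.
From mathcomp Require Import all_boot all_order all_algebra.
From mathcomp Require Import all_classical all_reals all_analysis.
Import Order.TTheory GRing.Theory Num.Theory.
Import numFieldNormedType.Exports.
Local Open Scope classical_set_scope.
Local Open Scope ring_scope.

(** When [e] ends at an internal vertex, every path counted in its edge vector is [e] followed by a
    path from some edge [f] leaving that vertex. Weight is multiplicative, winding and intersection
    number are additive, so prepending [e] costs the factor [w e] and the sign with exponent int(e)
    + wind(e, f), both independent of the rest of the path. Hence one relation holds at every
    internal vertex: the vector of [e] is the sum over all such [f] of that factor times the vector
    of [f]. It is [edge_series_first_edge] for power series, proved coefficient by coefficient, and
    [edge_vector_first_edge] for convergent weights, proved on partial sums. The three cases of the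
    theorem only count the edges [f]: one at a bivalent or black vertex, two at a trivalent white
    one. *)

Lemma big_tuple_cons (T : finType) (V : nmodType) (d : nat) (F : seq T -> V) :
  \sum_(P : d.+1.-tuple T) F P = \sum_(x : T) \sum_(P : d.-tuple T) F (x :: P).
Proof.
rewrite pair_big /=.
rewrite (reindex (fun p : T * d.-tuple T => [tuple of p.1 :: p.2])) //=.
exists (fun P : d.+1.-tuple T => (thead P, [tuple of behead P])) => [[x P] _|P _] /=.
  by rewrite theadE; congr pair; apply: val_inj.
by rewrite -tuple_eta.
Qed.

Section FirstEdge.
Context {R : realType} {k n : nat} {G : plabic_graph R k n} (l : R * R).
Implicit Types (e f : edge G) (P : seq (edge G)) (w : edge G -> R).

(** Winding sums over consecutive pairs and intersections over edges, so prepending [e] adds exactly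
    one term of each. *)
Lemma path_sign_cons e f P :
  path_sign l [:: e, f & P] =
  (-1) ^ ((int_edge l e)%:Z + wind l e f) * path_sign l (f :: P).
Proof.
rewrite /path_sign -exprzDr ?unitrN1 // /path_wind /path_int /= !big_cons /=.
by rewrite PoszD addrACA [X in (-1) ^ (X + _)]addrC.
Qed.

Lemma path_sign_norm P : `|path_sign l P| = 1.
Proof. by rewrite /path_sign expN1r normrX normrN1 expr1n. Qed.

(** [Q] and [F] are left arbitrary to serve both settings: [Q] fixes the edge multiplicities for a
    coefficient of the series, and is [predT] for actual weights. *)
Lemma sum_paths_cons e j d (Q : pred (seq (edge G))) (F : seq (edge G) -> R) :
  internal G (tgt G e) ->
  \sum_(P : d.+1.-tuple (edge G) | path_to e j P && Q P) F P =
  \sum_(f | src G f == tgt G e)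
     \sum_(P : d.-tuple (edge G) | path_to f j P && Q (e :: P)) F (e :: P).
Proof.
move=> ev.
rewrite big_mkcond (big_tuple_cons _ _ _ (fun P => if path_to e j P && Q P then F P else 0)) /=.
rewrite (bigD1 e) //= [X in _ + X]big1 ?addr0; last first.
  by move=> x /negbTE xe; apply: big1 => P _; rewrite xe.
under [RHS]eq_bigr do rewrite big_mkcond.
(* For a fixed tail, only its first edge can be [f]. An empty tail contributes to neither side: the
   path [[:: e]] would have to end at a boundary vertex. *)
rewrite [RHS]exchange_big; apply: eq_bigr => -[[|g P] sP] _ /=.
  rewrite eqxx /= [RHS]big1 //; case: eqP => //= tj.
  by move: ev; rewrite /internal tj codom_f.
rewrite eqxx /= [RHS]big_mkcond (bigD1 g) //= [X in _ = _ + X]big1 ?addr0.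
  by rewrite [src G g == _]eq_sym eqxx /=; case: eqP.
by move=> f /negbTE fg; rewrite [g == f]eq_sym fg; case: ifP.
Qed.

Lemma edge_series_first_edge e (m : monomial G) : internal G (tgt G e) ->
  edge_series l e m =
  \sum_(f | src G f == tgt G e)
     (-1) ^ ((int_edge l e)%:Z + wind l e f) *: mul_weight e (edge_series l f) m.
Proof.
move=> ev; apply/rowP => j; rewrite mxE summxE.
rewrite /mul_weight; case me: (m e) => [|c].
  (* Exponent 0 at [e]: both sides vanish, since every path from [e] uses [e] at least once. *)
  rewrite [RHS]big1 => [|f _]; last by rewrite scaler0 mxE.
  apply: big1 => -[[|g P] sP] //= /andP[/and3P[/eqP -> _ _] /forallP/(_ e)].
  by rewrite /= eqxx me.
(* [m'] is [m] divided by the indeterminate of [e], the monomial of the tail; its degree drops by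
   one, as does the length of the path. *)
set m' := finfun _.
have md : mdegree m = (mdegree m').+1.
  rewrite /mdegree (bigD1 e) //= [in RHS](bigD1 e) //= ffunE eqxx me subn1 /=.
  by rewrite addSn; congr (_ + _).+1%N; apply: eq_bigr => x /negbTE xe; rewrite ffunE xe subn0.
rewrite md (sum_paths_cons _ _ _ (fun P => [forall x, count_mem x P == m x])) //.
apply: eq_bigr => f _; rewrite !mxE mulr_sumr; apply: eq_big => [P|[[|g P] sP]] //.
  congr (_ && _); apply: eq_forallb => x /=; rewrite ffunE [e == x]eq_sym.
  by case: (x =P e) => [->|_]; rewrite ?me ?subn1 ?add1n ?add0n ?subn0 ?eqSS.
by case/andP=> /and3P[/eqP -> _ _] _; rewrite path_sign_cons.
Qed.

(** Signs have absolute value 1, so the series of path weights dominates this one absolutely. *)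
Lemma cvg_signed_paths w f j : (forall e, 0 < w e) -> paths_converge w ->
  cvgn (series (fun d : nat => \sum_(P : d.-tuple (edge G) | path_to f j P)
      path_sign l P * path_weight w P)).
Proof.
move=> w0 wc; apply: normed_cvg.
apply: series_le_cvg (wc f j) => [d|d|d] //=.
  by apply: sumr_ge0 => P _; apply: prodr_ge0 => x _; apply: ltW.
apply: le_trans (ler_norm_sum _ _ _) _; apply: ler_sum => P _.
rewrite normrM path_sign_norm mul1r ger0_norm //.
by apply: prodr_ge0 => x _; apply: ltW.
Qed.

Lemma edge_vector_first_edge w e : (forall e, 0 < w e) -> paths_converge w ->
  internal G (tgt G e) ->
  edge_vector l w e =
  \sum_(f | src G f == tgt G e)
     ((-1) ^ ((int_edge l e)%:Z + wind l e f) * w e) *: edge_vector l w f.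
Proof.
move=> w0 wc ev; apply/rowP => j; rewrite mxE summxE.
under [RHS]eq_bigr do rewrite !mxE.
apply: cvg_lim => //; rewrite -cvg_shiftS /=.
pose a f (d : nat) := \sum_(P : d.-tuple (edge G) | path_to f j P)
      path_sign l P * path_weight w P.
(* Dropping the first edge shortens paths by one, so lengths up to [N] from [e] match lengths below
   [N] from the edges [f]; length 0 contributes nothing, the empty sequence not being a path. *)
have -> : (fun N => series (a e) N.+1) = (fun N => \sum_(f | src G f == tgt G e)
    ((-1) ^ ((int_edge l e)%:Z + wind l e f) * w e) * series (a f) N).
  apply/funext => N; rewrite /series /= big_nat_recl //= {1}/a big1 ?add0r; last first.
    by case=> -[].
  under [RHS]eq_bigr do rewrite mulr_sumr.
  rewrite [RHS]exchange_big; apply: eq_bigr => d _; rewrite /a.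
  have := sum_paths_cons e j d predT (fun P => path_sign l P * path_weight w P) ev; rewrite /=.
  under eq_bigl do rewrite andbT.
  move=> ->; apply: eq_bigr => f _; rewrite mulr_sumr.
  under eq_bigl do rewrite andbT.
  apply: eq_bigr => -[[|g P] sP] //= /and3P[/eqP -> _ _].
  by rewrite path_sign_cons {1}/path_weight big_cons mulrACA.
apply: cvg_big => [|f _]; first exact: add_continuous.
by apply: cvgMl_tmp; exact: cvg_signed_paths.
Qed.

End FirstEdge.

Section InternalVertex.
Context {R : realType} {k n : nat} {G : plabic_graph R k n}.

(** Out-degrees turn the sum over leaving edges into the explicit one-term and, below, two-term
    right-hand sides. *)
Lemma big_outdeg1 (V : nmodType) v (f : edge G) (F : edge G -> V) :
  outdeg G v = 1%N -> src G f = v -> \sum_(g | src G g == v) F g = F f.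
Proof.
move=> o1 /eqP fv; rewrite (bigD1 f) //= big_pred0 ?addr0 // => g.
by move: o1; rewrite /outdeg (cardD1 f) inE fv => -[] /card0_eq/(_ g); rewrite !inE andbC.
Qed.

Lemma big_outdeg2 (V : nmodType) v (f1 f2 : edge G) (F : edge G -> V) :
  outdeg G v = 2%N -> src G f1 = v -> src G f2 = v -> f1 != f2 ->
  \sum_(g | src G g == v) F g = F f1 + F f2.
Proof.
move=> o2 /eqP f1v /eqP f2v; rewrite eq_sym => f21.
rewrite (bigD1 f1) //= (bigD1 f2) ?f2v //= big_pred0 ?addr0 // => g.
move: o2; rewrite /outdeg (cardD1 f1) (cardD1 f2) !inE f1v f2v f21 => -[].
by move=> /card0_eq/(_ g); rewrite !inE => <-; rewrite andbC [X in _ && X]andbC.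
Qed.

(** Either colour works: white leaves 2 - 1 outgoing edges, black has one by definition. *)
Lemma bivalent_outdeg (v : vertex G) :
  internal G v -> degree G v = 2%N -> outdeg G v = 1%N.
Proof.
move=> iv; have [wv|bv] := boolP (white G v); last by rewrite (black_outdeg iv).
by rewrite /degree (white_indeg iv wv) => -[].
Qed.

Lemma white_trivalent_outdeg (v : vertex G) :
  internal G v -> white G v -> degree G v = 3%N -> outdeg G v = 2%N.
Proof. by move=> iv wv; rewrite /degree (white_indeg iv wv) => -[]. Qed.

End InternalVertex.

Theorem lemma3p10 (R : realType) (k n : nat) (hkn : (0 < k < n)%N)
    (G : plabic_graph R k n) (w : edge G -> R) (hw : forall e, 0 < w e)
    (l : R * R) (hl : gauge_direction G l) :
  (* as formal power series in the weights *)
  [/\ forall v (e f : edge G),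
        internal G v -> degree G v = 2%N -> tgt G e = v -> src G f = v ->
        edge_series l e =
          (fun m => (-1) ^ ((int_edge l e)%:Z + wind l e f)
                      *: mul_weight e (edge_series l f) m),
      forall v (e1 e2 e3 : edge G),
        internal G v -> degree G v = 3%N -> ~~ white G v ->
        tgt G e2 = v -> tgt G e3 = v -> e2 != e3 -> src G e1 = v ->
        edge_series l e2 =
          (fun m => (-1) ^ ((int_edge l e2)%:Z + wind l e2 e1)
                      *: mul_weight e2 (edge_series l e1) m) /\
        edge_series l e3 =
          (fun m => (-1) ^ ((int_edge l e3)%:Z + wind l e3 e1)
                      *: mul_weight e3 (edge_series l e1) m)
    & forall v (e1 e2 e3 : edge G),
        internal G v -> degree G v = 3%N -> white G v ->
        tgt G e3 = v -> src G e1 = v -> src G e2 = v -> e1 != e2 ->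
        edge_series l e3 =
          (fun m => (-1) ^ ((int_edge l e3)%:Z + wind l e3 e1)
                      *: mul_weight e3 (edge_series l e1) m
                  + (-1) ^ ((int_edge l e3)%:Z + wind l e3 e2)
                      *: mul_weight e3 (edge_series l e2) m)]
  /\
  (* as vectors in R^n, for weights at which the sums converge *)
  (paths_converge w ->
   [/\ forall v (e f : edge G),
        internal G v -> degree G v = 2%N -> tgt G e = v -> src G f = v ->
        edge_vector l w e =
          ((-1) ^ ((int_edge l e)%:Z + wind l e f) * w e)
            *: edge_vector l w f,
      forall v (e1 e2 e3 : edge G),
        internal G v -> degree G v = 3%N -> ~~ white G v ->
        tgt G e2 = v -> tgt G e3 = v -> e2 != e3 -> src G e1 = v ->
        edge_vector l w e2 =
          ((-1) ^ ((int_edge l e2)%:Z + wind l e2 e1) * w e2)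
            *: edge_vector l w e1 /\
        edge_vector l w e3 =
          ((-1) ^ ((int_edge l e3)%:Z + wind l e3 e1) * w e3)
            *: edge_vector l w e1
    & forall v (e1 e2 e3 : edge G),
        internal G v -> degree G v = 3%N -> white G v ->
        tgt G e3 = v -> src G e1 = v -> src G e2 = v -> e1 != e2 ->
        edge_vector l w e3 =
          ((-1) ^ ((int_edge l e3)%:Z + wind l e3 e1) * w e3)
            *: edge_vector l w e1
        + ((-1) ^ ((int_edge l e3)%:Z + wind l e3 e2) * w e3)
            *: edge_vector l w e2]).
Proof.
split=> [|wc]; split.
- move=> v e f iv dv ev fv; apply/funext => m.
  rewrite edge_series_first_edge ev //.
  by rewrite (big_outdeg1 _ _ _ _ (bivalent_outdeg _ iv dv) fv).
(* The incoming edges are treated separately, each having [e1] as its only continuation. *)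
- move=> v e1 e2 e3 iv _ bv ev2 ev3 _ fv; have o1 := black_outdeg iv bv.
  by split; apply/funext => m; rewrite edge_series_first_edge ?ev2 ?ev3 //
    (big_outdeg1 _ _ _ _ o1 fv).
- move=> v e1 e2 e3 iv dv wv ev f1v f2v f12; apply/funext => m.
  rewrite edge_series_first_edge ev //.
  by rewrite (big_outdeg2 _ _ _ _ _ (white_trivalent_outdeg _ iv wv dv) f1v f2v f12).
- move=> v e f iv dv ev fv.
  rewrite edge_vector_first_edge ?ev //.
  by rewrite (big_outdeg1 _ _ _ _ (bivalent_outdeg _ iv dv) fv).
- move=> v e1 e2 e3 iv _ bv ev2 ev3 _ fv; have o1 := black_outdeg iv bv.
  by split; rewrite edge_vector_first_edge ?ev2 ?ev3 // (big_outdeg1 _ _ _ _ o1 fv).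
- move=> v e1 e2 e3 iv dv wv ev f1v f2v f12.
  rewrite edge_vector_first_edge ?ev //.
  by rewrite (big_outdeg2 _ _ _ _ _ (white_trivalent_outdeg _ iv wv dv) f1v f2v f12).
Qed.
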